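(* Let $x,z\in\mathbf{I}_*$ with $x\le z$. Then $$\sum_{y\in\mathbf{I}_*;\,x\le y\le z}\kappa(x)\kappa(y)=\delta_{x,z}.$$
   Context: $W$ is a Coxeter group with set of simple reflections $S$, length function $l:W\to\mathbf{N}$ and Bruhat order $\le$. $w\mapsto w^*$ is an automorphism of $W$ with square $1$ which leaves $S$ stable. $\mathbf{I}_*=\{w\in W : (w^* )^{-1}=w\}$, partially ordered by the restriction of $\le$. $\delta_{x,z}$ is $1$ if $x=z$ and $0$ otherwise. $\phi:\mathbf{I}_*\to\mathbf{N}$ is the unique function such that $\phi(1)=0$ and for any $w\in\mathbf{I}_*$ and $s\in S$ with $sw<w$ one has $\phi(w)=\phi(sw)+1$ if $sw=ws^*$ and $\phi(w)=\phi(sws^* )$ if $sw\neq ws^*$. One has $l(w)\equiv\phi(w)\bmod 2$, and $\kappa(w)=(-1)^{(l(w)+\phi(w))/2}\in\{1,-1\}$ for $w\in\mathbf{I}_*$. *)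

(* Defs.v *)
From Stdlib Require Import Relation_Operators.
From HB Require Import structures.
From mathcomp Require Import all_boot all_order all_algebra.
From mathcomp Require Import boolp classical_sets functions cardinality fsbigop.

Set Implicit Arguments.
Unset Strict Implicit.
Unset Printing Implicit Defensive.

Import GRing.Theory.
Local Open Scope group_scope.

Section CoxeterGroups.
Variables (W : groupType) (S : set W).
Implicit Types (w x y s t : W) (n : nat).

Definition has_order (G : groupType) (g : G) n : Prop :=
  [/\ (0 < n)%N, g ^+ n = 1 & forall k, (0 < k)%N -> g ^+ k = 1 -> (n <= k)%N].

Definition word (ws : seq W) : Prop := forall s, s \in ws -> S s.

Definition expressible n w : Prop :=
  exists ws : seq W, [/\ word ws, size ws = n & w = \prod_(s <- ws) s].

(* W has the presentation < S | (s s')^m(s,s') = 1 >, where m(s,s') is the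
   order of s s' in W and there is no relation when that order is infinite; the
   presentation is expressed by its universal property. S may be infinite. *)
Definition coxeter_system : Prop :=
  [/\ forall s, S s -> has_order s 2,
      forall w, exists n, expressible n w
    & forall (G : groupType) (f : W -> G),
        (forall s s' n, S s -> S s' -> has_order (s * s') n ->
           (f s * f s') ^+ n = 1) ->
        exists g : {multiplicative W -> G}, forall s, S s -> g s = f s].

(* The default value 0 of xget is not used when S generates W. *)
Definition coxlen w : nat :=
  xget 0%N [set n | expressible n w /\
                    forall k, expressible k w -> (n <= k)%N].

Definition reflection t : Prop := exists2 s, S s & exists w, t = w * s * w^-1.

Definition bruhat_step x y : Prop :=
  exists2 t, reflection t & y = t * x /\ (coxlen x < coxlen y)%N.

Definition bruhat_le : W -> W -> Prop := clos_refl_trans W bruhat_step.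

Definition bruhat_lt x y : Prop := bruhat_le x y /\ x <> y.

Variable star : W -> W.

Definition twisted_involutions : set W := [set w | (star w)^-1 = w].

(* Only the values of phi on twisted_involutions matter. *)
Definition is_phi (phi : W -> nat) : Prop :=
  phi 1 = 0%N /\
  forall w s, twisted_involutions w -> S s -> bruhat_lt (s * w) w ->
    (s * w = w * star s -> phi w = (phi (s * w)).+1) /\
    (s * w <> w * star s -> phi w = phi (s * w * star s)).

(* coxlen w + phi w is even on twisted_involutions, so the halving is exact. *)
Definition kappa (phi : W -> nat) w : int :=
  ((-1) ^+ (coxlen w + phi w)./2)%R.

Definition bruhat_interval x z : set W :=
  [set y | [/\ twisted_involutions y, bruhat_le x y & bruhat_le y z]].

End CoxeterGroups.

(* Main.v *)
(**
For [s] in [S] and [w] in [I_*] put [s.w = s w] if [s w = w s^*] and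
[s.w = s w s^*] otherwise. Then [w |-> s.w] is an involution of [I_*] which
exchanges [{s w < w}] and [{s w > w}] and changes the sign of [kappa], and the
lifting property of the Bruhat order carries over to it. Induct on the length of
[z], with [s z < z]. If [s x > x], the interval [[x, z]] is stable under
[y |-> s.y], so the sum vanishes. If [s x < x], write [T(x, z)] for the sum of
[kappa] over [[x, z]]; splitting the intervals according to whether [s y < y]
gives [T(x, z) + T(s.x, s.z) = T(x, s.z)], and induction applies to the last two
terms.

The lifting property rests on the fact that [l(t w) < l(w)] is a cocycle in [w]
for every reflection [t]. The universal property of the presentation yields a
homomorphism from [W] to the semidirect product of [W] and the functions
[W -> bool] sending [s] to [(s, delta_s)], whose second component is this cocycle.
*)
Require Import Defs.
From Stdlib Require Import Relation_Operators Operators_Properties.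
From HB Require Import structures.
From mathcomp Require Import all_boot all_order all_algebra.
From mathcomp Require Import boolp classical_sets functions cardinality fsbigop.

Set Implicit Arguments.
Unset Strict Implicit.
Unset Printing Implicit Defensive.

Import GRing.Theory Num.Theory.
Local Open Scope group_scope.

(** * The semidirect product of [W] and the functions [W -> bool] *)

Lemma conjg_eq (W : groupType) (x y u : W) : (x ^ u == y) = (x == y ^ u^-1).
Proof. exact: can2_eq (conjgK u) (conjgKV u) x y. Qed.

(* A pair (w, e) stands for the permutation (t, b) |-> (w^-1 t w, e t (+) b) of
   W * bool, acting on the right. *)
Definition signed_conj (W : groupType) : Type := (W * (W -> bool))%type.

Section SignedConjugation.
Variable W : groupType.
Implicit Types (p q : signed_conj W) (s t : W).

HB.instance Definition _ := gen_eqMixin (signed_conj W).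
HB.instance Definition _ := gen_choiceMixin (signed_conj W).

Definition sc_mul p q : signed_conj W :=
  (p.1 * q.1, fun t => p.2 t (+) q.2 (t ^ p.1)).
Definition sc_one : signed_conj W := (1, fun=> false).
Definition sc_inv p : signed_conj W := (p.1^-1, fun t => p.2 (t ^ p.1^-1)).

Fact sc_mulA : associative sc_mul.
Proof.
move=> p q r; congr pair; first exact: mulgA.
by apply/funext => t /=; rewrite conjgM addbA.
Qed.
Fact sc_mul1 : left_id sc_one sc_mul.
Proof.
by case=> w e; congr pair; [exact: mul1g|apply/funext => t /=; rewrite conjg1].
Qed.
Fact sc_muln1 : right_id sc_one sc_mul.
Proof.
by case=> w e; congr pair; [exact: mulg1|apply/funext => t /=; rewrite addbF].
Qed.
Fact sc_mulV : left_inverse sc_one sc_inv sc_mul.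
Proof.
by case=> w e; congr pair; [exact: mulVg|apply/funext => t /=; rewrite addbb].
Qed.
Fact sc_mulnV : right_inverse sc_one sc_inv sc_mul.
Proof.
case=> w e; congr pair; first exact: mulgV.
by apply/funext => t /=; rewrite conjgK addbb.
Qed.
HB.instance Definition _ :=
  isGroup.Build (signed_conj W) sc_mulA sc_mul1 sc_muln1 sc_mulV sc_mulnV.

Definition sc_gen s : signed_conj W := (s, fun t => t == s).

(* The relators hold because, when [(s * s') ^+ n = 1], each term of this sum
   occurs twice. *)
Lemma sc_genX s s' n : s * s = 1 -> s' * s' = 1 ->
  (sc_gen s * sc_gen s') ^+ n =
  ((s * s') ^+ n, fun t =>
     \big[addb/false]_(j < n + n) (t == (s * s') ^+ j * s)).
Proof.
move=> ss ss'; set a := s * s'.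
have sV : s^-1 = s by apply: mulg1_eq.
have s'V : s'^-1 = s' by apply: mulg1_eq.
(* The dihedral relation: [s] inverts [a], so [s] moves past powers of [a]. *)
have aV : a^-1 = a ^ s by rewrite /a conjgE invgM sV s'V !mulgA ss mul1g.
have sa k : s * a ^- k = a ^+ k * s.
  by rewrite -expVgn aV -conjXg conjgE sV mulgA mulgA ss mul1g.
elim: n => [|n IHn].
  by congr pair; apply/funext => t; rewrite big_ord0.
rewrite expgSr IHn expgSr; congr pair; apply/funext => t /=.
(* The new terms have indices [n + n] and [(n + n).+1]: conjugating [s] and [s'] back gives
   [a ^+ (n + n) * s] and [a ^+ (n + n).+1 * s]. *)
rewrite addnS addSn !big_ord_recr /= -addbA; congr (_ (+) (_ (+) _)).
  rewrite conjg_eq conjgE invgK.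
  by rewrite sa mulgA expgnDr.
rewrite -conjgM conjg_eq conjgE invgK invgM sV.
by rewrite !mulgA -[_ * s * s']mulgA -/a -expgSr -mulgA sa mulgA -expgnDr addSn.
Qed.

End SignedConjugation.

(** * Words and the length function *)

Section Coxeter.
Variables (W : groupType) (S : set W) (cox : coxeter_system S).
Implicit Types (w x y z s t : W) (n k : nat) (ws : seq W).
Local Notation len := (coxlen S).
Local Notation "x ≤ y" := (bruhat_le S x y) (at level 70).

Lemma genM s : S s -> s * s = 1.
Proof. by case: cox => h _ _ /h[]. Qed.

Lemma genV s : S s -> s^-1 = s.
Proof. by move=> /genM; apply: mulg1_eq. Qed.

Lemma genK s w : S s -> s * (s * w) = w.
Proof. by move=> /genM ss; rewrite mulgA ss mul1g. Qed.

Lemma genKr s w : S s -> w * s * s = w.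
Proof. by move=> /genM ss; rewrite -mulgA ss mulg1. Qed.

Lemma expressible1 : expressible S 0 1.
Proof. by exists [::]; split; rewrite ?big_nil. Qed.

Lemma expressibleMl n s w : S s -> expressible S n w ->
  expressible S n.+1 (s * w).
Proof.
move=> Ss [ws [wws <- ->]]; exists (s :: ws); split; rewrite ?big_cons//.
by move=> s'; rewrite inE => /predU1P[->//|/wws].
Qed.

Lemma coxlenP w :
  expressible S (len w) w /\ forall k, expressible S k w -> (len w <= k)%N.
Proof.
rewrite /coxlen; case: xgetP => [n -> []//|none].
have ex : exists n, `[<expressible S n w>].
  by case: cox => _ /(_ w)[n wn] _; exists n; apply/asboolP.
case: (none (ex_minn ex)); case: ex_minnP => n /asboolP wn nmin; split=> // k wk.
exact/nmin/asboolP.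
Qed.

Lemma coxlen_min w k : expressible S k w -> (len w <= k)%N.
Proof. by case: (coxlenP w) => _; apply. Qed.

Lemma coxlen1 : len 1 = 0%N.
Proof. by apply/eqP; rewrite -leqn0 coxlen_min//; exact: expressible1. Qed.

Lemma coxlen_eq0 w : len w = 0%N -> w = 1.
Proof.
by case: (coxlenP w) => + _ => /[swap] -> [ws [_ /size0nil-> ->]]; rewrite big_nil.
Qed.

Lemma coxlenMl s w : S s -> (len (s * w) <= (len w).+1)%N.
Proof. by move=> Ss; apply/coxlen_min/expressibleMl => //; case: (coxlenP w). Qed.

Lemma coxlenV w : len w^-1 = len w.
Proof.
suff leV u : (len u^-1 <= len u)%N.
  by apply/eqP; rewrite eqn_leq leV -{1}[w]invgK leV.
case: (coxlenP u) => -[ws [wws sz u_ws]] _.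
apply: coxlen_min; exists (rev ws); split.
- by move=> s; rewrite mem_rev => /wws.
- by rewrite size_rev.
rewrite u_ws; elim: ws wws {sz u_ws} => [|s ws IH] wws.
  by rewrite /= !big_nil invg1.
rewrite rev_cons -cats1 big_cat /= big_seq1 big_cons invgM IH.
  by rewrite genV//; apply: wws; rewrite mem_head.
by move=> s' s'ws; apply: wws; rewrite inE s'ws orbT.
Qed.

Lemma gen_ind (P : W -> Prop) :
  P 1 -> (forall s w, S s -> P w -> P (s * w)) -> forall w, P w.
Proof.
move=> P1 PM w; case: (coxlenP w) => -[ws [wws _ ->]] _.
elim: ws wws => [|s ws IH] wws; rewrite ?big_nil// big_cons.
apply: PM; first by apply: wws; rewrite mem_head.
by apply: IH => s' s'ws; apply: wws; rewrite inE s'ws orbT.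
Qed.

(** * Reflections and the inversion cocycle *)

Lemma reflection_gen s : S s -> reflection S s.
Proof. by move=> Ss; exists s => //; exists 1; rewrite mul1g invg1 mulg1. Qed.

Lemma reflectionJ t w : reflection S t -> reflection S (t ^ w).
Proof.
case=> s Ss [u ->]; exists s => //; exists (w^-1 * u).
by rewrite conjgE invgM invgK !mulgA.
Qed.

Lemma reflectionM t : reflection S t -> t * t = 1.
Proof. by case=> s Ss [u ->]; rewrite !mulgA mulgVK genKr// mulgV. Qed.

(** If [L w t] holds, some letter of a word for [w] accounts for it, and deleting that letter gives
    a word for [t * w] (strong exchange). Conversely [L t t] holds, so if [L w t] fails then
    [L (t * w) t] holds and [w] is shorter than [t * w]. *)
Lemma reflection_cocycle : exists L : W -> W -> bool,
  [/\ forall w w' t, L (w * w') t = L w t (+) L w' (t ^ w),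
      forall s t, S s -> L s t = (t == s)
    & forall w t, reflection S t -> L w t = (len (t * w) < len w)%N].
Proof.
have [_ _ univ] := cox.
have [s s' n Ss Ss' [_ ss'n _]|g gS] := univ (signed_conj W) (@sc_gen W).
  rewrite sc_genX ?genM// ss'n; congr pair; apply/funext => t.
  rewrite big_split_ord /=.
  under [X in _ (+) X]eq_bigr do rewrite expgnDr ss'n mul1g.
  exact: addbb.
have g1 : g 1 = 1 by apply: (@mulgI _ (g 1)); rewrite -gmulfM !mulg1.
have gE w : (g w).1 = w.
  elim/gen_ind: w => [|s w Ss IH]; first by rewrite g1.
  by rewrite gmulfM gS//= IH.
pose L w t := (g w).2 t.
have LM w w' t : L (w * w') t = L w t (+) L w' (t ^ w).
  by rewrite /L gmulfM /= gE.
have LS s t : S s -> L s t = (t == s) by move=> Ss; rewrite /L gS.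
have L1 t : L 1 t = false by rewrite /L g1.
exists L; split=> // w t rt.
have Llt u : L u t -> (len (t * u) < len u)%N.
  (* Arbitrary words are allowed, with their size as bound, so that the induction can drop the first
     letter. *)
  suff del : forall ws t, word S ws -> L (\prod_(s <- ws) s) t ->
      exists2 n, (n < size ws)%N & expressible S n (t * \prod_(s <- ws) s).
    have [ws [wws sz u_ws]] := (coxlenP u).1; rewrite u_ws => Lut.
    have [n ltn tun] := del _ _ wws Lut.
    by rewrite -u_ws sz in ltn tun *; apply: leq_ltn_trans ltn; exact: coxlen_min.
  elim=> [|s ws IH] t' wws; first by rewrite big_nil L1.
  have Ss : S s by apply: wws; rewrite mem_head.
  have {}wws : word S ws by move=> s' s'ws; apply: wws; rewrite inE s'ws orbT.
  rewrite big_cons LM LS//; have [-> _|_ /= /(IH _ wws)[n ltn e]] := eqVneq t' s.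
    by exists (size ws); rewrite //= genK//; exists ws.
  exists n.+1 => //; have := expressibleMl Ss e.
  by rewrite conjgE genV// !mulgA genM// mul1g.
have Ltt : L t t.
  case: rt => s Ss [u ->].
  (* The contributions of [u] and [u^-1] add up to [L 1 t] and cancel; the middle letter contributes
     [L s s]. *)
  have := L1 (u * s * u^-1); rewrite -(mulgV u) !LM (LS s)//.
  have -> : (u * s * u^-1) ^ u = s by rewrite conjgE !mulgA mulgVK mulVg mul1g.
  have -> : (u * s * u^-1) ^ (u * s) = s.
    by rewrite conjgE invgM !mulgA mulgVK mulgVK mulVg mul1g.
  by rewrite eqxx; case: (L u _); case: (L _ s).
have [/Llt->//|nL] := boolP (L w t); apply/esym/negbTE; rewrite -leqNgt ltnW//.
have := Llt (t * w); rewrite mulgA reflectionM// mul1g; apply.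
by rewrite LM Ltt conjgE mulKg.
Qed.

(** The left inversions of [w] when [t] is a reflection; its left descents when [t] is simple. *)
Definition shortens t w := (len (t * w) < len w)%N.

Lemma shortensM t w w' : reflection S t ->
  shortens t (w * w') = shortens t w (+) shortens (t ^ w) w'.
Proof.
move=> rt; have [L [LM _ LE]] := reflection_cocycle.
by rewrite /shortens -!LE ?LM//; exact: reflectionJ.
Qed.

Lemma shortens_gen s t : S s -> reflection S t -> shortens t s = (t == s).
Proof.
by move=> Ss rt; have [L [_ LS LE]] := reflection_cocycle; rewrite -LS// LE.
Qed.

Lemma shortensN t w : reflection S t -> shortens t (t * w) = ~~ shortens t w.
Proof.
move=> rt; rewrite shortensM// conjgE mulKg.
suff -> : shortens t t by [].
rewrite /shortens reflectionM// coxlen1 lt0n; apply/eqP => /coxlen_eq0 t1.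
case: rt => s Ss [u]; rewrite t1 => /(congr1 (fun x => x ^ u)).
rewrite conj1g conjgE !mulgA mulgVK mulVg mul1g => s1.
by have [/(_ s Ss)[_ _ /(_ 1%N erefl)]] := cox; rewrite -s1 => /(_ erefl).
Qed.

Lemma coxlen_shortens s w : S s -> shortens s w -> len w = (len (s * w)).+1.
Proof.
move=> Ss sw; apply/eqP; rewrite eqn_leq [X in _ && X]sw andbT.
by have := coxlenMl (s * w) Ss; rewrite genK.
Qed.

Lemma shortens_ex w : w <> 1 -> exists2 s, S s & shortens s w.
Proof.
have [[[|s ws] [wws sz wE]] _] := coxlenP w; first by rewrite wE big_nil.
have Ss : S s by apply: wws; rewrite mem_head.
move=> _; exists s => //; rewrite /shortens -sz ltnS.
apply: coxlen_min; exists ws; split=> //; last by rewrite wE big_cons genK.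
by move=> s' s'ws; apply: wws; rewrite inE s'ws orbT.
Qed.

(** * The Bruhat order and its lifting property *)

Lemma bruhat_refl x : x ≤ x. Proof. exact: rt_refl. Qed.

Lemma bruhat_trans y x z : x ≤ y -> y ≤ z -> x ≤ z.
Proof. exact: rt_trans. Qed.

Lemma bruhat_shortens t w : reflection S t -> shortens t w -> t * w ≤ w.
Proof.
move=> rt tw; apply: rt_step; exists t => //; split=> //.
by rewrite mulgA reflectionM// mul1g.
Qed.

Lemma bruhat_lengthens t w : reflection S t -> ~~ shortens t w -> w ≤ t * w.
Proof.
move=> rt tw; rewrite -{1}[w]mul1g -(reflectionM rt) -mulgA.
by apply: bruhat_shortens => //; rewrite shortensN.
Qed.

Lemma bruhat_coxlen x y : x ≤ y -> (len x <= len y)%N.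
Proof.
by elim=> // [u v [t _ [_ /ltnW]]//|u v w _ uv _]; apply: leq_trans.
Qed.

(** Since [(t * u)^-1 = t ^ u * u^-1], inverting a step gives a step by a conjugate reflection. *)
Lemma bruhatV x y : x ≤ y -> x^-1 ≤ y^-1.
Proof.
elim=> [u v [t rt [-> uv]]|u|u v w _ + _]; last 2 first.
- exact: bruhat_refl.
- exact: bruhat_trans.
apply: rt_step; exists (t ^ u); first exact: reflectionJ.
have tV : t^-1 = t by apply: mulg1_eq; exact: reflectionM.
rewrite !coxlenV; split=> //.
by rewrite invgM tV conjgE -!mulgA mulgV mulg1.
Qed.

(** The step by [t] becomes a step by [t ^ s]. By the cocycle identity its direction could be
    reversed only if [t ^ s = s], that is [t = s]. *)
Lemma bruhat_step_gen s x y : S s -> bruhat_step S x y ->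
  s * x = y \/ bruhat_step S (s * x) (s * y).
Proof.
move=> Ss [t rt [yE xy]]; have [<-|/eqP ts] := eqVneq t s; first by left.
have rts : reflection S (t ^ s) by exact: reflectionJ.
have sV := genV Ss.
have e : s * y = t ^ s * (s * x).
  by rewrite yE conjgE sV -!mulgA genK.
right; exists (t ^ s) => //; split=> //.
have -> : s * x = t ^ s * (s * y) by rewrite e mulgA reflectionM// mul1g.
rewrite -/(shortens _ _) shortensM// shortens_gen// -conjgM genM// conjg1.
have -> : shortens t y by rewrite /shortens {1}yE mulgA reflectionM// mul1g.
rewrite addbT; apply/eqP => tss; apply: ts; move: tss.
by move=> /(congr1 (fun x => x ^ s)); rewrite -conjgM genM// conjg1 conjgE mulKg.
Qed.

(** Translate a chain from [x] to [y] by [s] up to the first step with [s * u = v]; from [v] the old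
    chain leads on to [y]. The next lemma does the same from the top end. *)
Lemma bruhat_gen_up s x y : S s -> x ≤ y -> s * x ≤ y \/ s * x ≤ s * y.
Proof.
move=> Ss xy; have {xy} := clos_rt_rt1n _ _ _ _ xy; elim=> [u|u v w uv vw IH].
  by right; exact: bruhat_refl.
have [-> |suv] := bruhat_step_gen Ss uv.
  by left; exact: clos_rt1n_rt.
by case: IH => [svw|svw]; [left|right]; apply: bruhat_trans svw; exact: rt_step.
Qed.

Lemma bruhat_gen_down s x y : S s -> x ≤ y -> x ≤ s * y \/ s * x ≤ s * y.
Proof.
move=> Ss xy; have {xy} := clos_rt_rtn1 _ _ _ _ xy; elim=> [|u v uv xu IH].
  by right; exact: bruhat_refl.
have [<-|suv] := bruhat_step_gen Ss uv.
  by left; rewrite genK//; exact: clos_rtn1_rt.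
by case: IH => [xsu|xsu]; [left|right]; apply: bruhat_trans xsu _;
  exact: rt_step.
Qed.

Lemma bruhat_liftl_up s x y : S s -> shortens s y -> x ≤ y -> s * x ≤ y.
Proof.
move=> Ss sy /(bruhat_gen_up Ss)[//|sxy]; apply: bruhat_trans sxy _.
by apply: bruhat_shortens => //; exact: reflection_gen.
Qed.

Lemma bruhat_liftl_down s x y : S s -> ~~ shortens s x -> x ≤ y -> x ≤ s * y.
Proof.
move=> Ss sx /(bruhat_gen_down Ss)[//|sxy]; apply: bruhat_trans sxy.
by apply: bruhat_lengthens => //; exact: reflection_gen.
Qed.

Lemma bruhat_liftr_up s x y : S s -> shortens s y^-1 -> x ≤ y -> x * s ≤ y.
Proof.
move=> Ss sy /bruhatV/(bruhat_liftl_up Ss sy)/bruhatV.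
by rewrite invgM !invgK genV.
Qed.

Lemma bruhat_liftr_down s x y : S s -> ~~ shortens s x^-1 -> x ≤ y -> x ≤ y * s.
Proof.
move=> Ss sx /bruhatV/(bruhat_liftl_down Ss sx)/bruhatV.
by rewrite invgM !invgK genV.
Qed.

Lemma bruhat_le1 x : x ≤ 1 -> x = 1.
Proof.
by move=> /bruhat_coxlen; rewrite coxlen1 leqn0 => /eqP/coxlen_eq0.
Qed.

(** By lifting, for a left descent [s] of [z] the ideal below [z] lies in the union of the ideal
    below [s * z] and its translate by [s]; this works for infinite [S] too. *)
Lemma finite_bruhat_ideal z : finite_set [set y | y ≤ z].
Proof.
have [n] := ubnP (len z); elim: n z => // n IH z; rewrite ltnS => lz.
have [->|/eqP/shortens_ex[s Ss sz]] := eqVneq z 1.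
  by apply: sub_finite_set (finite_set1 1) => y /bruhat_le1.
have {}IH := IH (s * z) (leq_trans sz lz).
apply: sub_finite_set (_ : finite_set
  ([set y | y ≤ s * z] `|` [set s * y | y in [set y | y ≤ s * z]])).
  move=> y /= yz; have [sy|sy] := boolP (shortens s y); [right|left].
    exists (s * y); rewrite ?genK//; apply: bruhat_liftl_down => //.
      by rewrite shortensN ?sy//; exact: reflection_gen.
    by apply: bruhat_trans yz; apply: bruhat_shortens => //; exact: reflection_gen.
  exact: bruhat_liftl_down.
by rewrite finite_setU; split=> //; exact: finite_image.
Qed.

(** * Twisted involutions and the action of simple reflections *)

Section Twisted.
Variables (star : {multiplicative W -> W}).
Hypotheses (starK : forall w, star (star w) = w)
  (starS : forall s, S s -> S (star s)).
Local Notation I := (twisted_involutions star).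

Lemma coxlen_star w : len (star w) = len w.
Proof.
suff le_star u : (len (star u) <= len u)%N.
  by apply/eqP; rewrite eqn_leq le_star -{1}[w]starK le_star.
have star1 : star 1 = 1 by apply: (@mulgI _ (star 1)); rewrite -gmulfM !mulg1.
have [[ws [wws <- uE]] _] := coxlenP u; rewrite uE.
apply: coxlen_min; exists (map star ws); split; last 2 first.
- by rewrite size_map.
- by rewrite big_map; apply: (big_morph star) => //; exact: gmulfM.
by move=> s /mapP[s' /wws Ss' ->]; exact: starS.
Qed.

Definition twisted_act s w :=
  if s * w == w * star s then s * w else s * w * star s.
Local Notation act := twisted_act.

Lemma twisted_actK s w : S s -> act s (act s w) = w.
Proof.
move=> Ss; have Ss' := starS Ss; rewrite {2}/twisted_act; case: eqP => [e|ne].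
  by rewrite /twisted_act genK// e genKr// -e eqxx.
rewrite /twisted_act !mulgA genM// mul1g genKr//; case: eqP => [e|_].
  by case: ne; rewrite -e.
exact: genKr.
Qed.

Lemma twisted_star w : I w -> star w = w^-1.
Proof. by move=> Iw; rewrite -[in RHS]Iw invgK. Qed.

Lemma twisted_act_closed s w : S s -> I w -> I (act s w).
Proof.
move=> Ss /twisted_star Iw; rewrite /twisted_involutions /= /twisted_act.
case: eqP => [e|_].
  by rewrite gmulfM Iw invgM invgK genV ?e//; exact: starS.
by rewrite !gmulfM Iw starK !invgM invgK !genV ?mulgA//; exact: starS.
Qed.

(** Turns a left descent [s] into a right descent [star s], as lifting on the right requires. *)
Lemma shortens_twisted_inv s w : I w -> shortens (star s) w^-1 = shortens s w.
Proof.
by move=> /twisted_star Iw; rewrite /shortens coxlenV -Iw -gmulfM coxlen_star.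
Qed.

(** By the cocycle identity, the factor [star s] on the right matters only if
    [s ^ (s * w) = star s], which means [s * w = w * star s]. *)
Lemma shortens_twisted_act s w : S s -> I w ->
  shortens s (act s w) = ~~ shortens s w.
Proof.
move=> Ss Iw; have rs := reflection_gen Ss.
rewrite /twisted_act; case: eqP => [_|ne]; first by rewrite shortensN.
rewrite shortensM// shortensN// (shortens_gen (starS Ss)); last exact: reflectionJ.
case: eqP => [e|_]; last by rewrite addbF.
by case: ne; rewrite -e conjgM [s ^ s]conjgE mulKg conjgE mulVKg.
Qed.

(** In the second case [s] lengthens [act s w] to [w * star s], which has the length of [s * w]
    because inversion and [star] preserve length. *)
Lemma coxlen_twisted_act s w : S s -> I w -> shortens s w ->
  len w = (if s * w == w * star s then (len (act s w)).+1
           else (len (act s w)).+2).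
Proof.
move=> Ss Iw sw; rewrite (coxlen_shortens Ss sw).
case: ifPn => e; first by rewrite /twisted_act e.
have := shortens_twisted_act Ss Iw; rewrite sw /= => /negbT.
rewrite -shortensN; last exact: reflection_gen.
move=> /(coxlen_shortens Ss); rewrite genK// => <-.
congr _.+1; rewrite /twisted_act (negbTE e) !mulgA genM// mul1g.
rewrite -[RHS]coxlenV invgM genV; last exact: starS.
by rewrite -(twisted_star Iw) -gmulfM coxlen_star.
Qed.

Lemma twisted_act_up s y z : S s -> I z -> shortens s z -> y ≤ z -> act s y ≤ z.
Proof.
move=> Ss Iz sz yz; have syz := bruhat_liftl_up Ss sz yz.
rewrite /twisted_act; case: ifP => // _.
by apply: bruhat_liftr_up => //; [exact: starS|rewrite shortens_twisted_inv].
Qed.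

Lemma twisted_act_down s x y :
  S s -> I x -> ~~ shortens s x -> x ≤ y -> x ≤ act s y.
Proof.
move=> Ss Ix sx xy; have xsy := bruhat_liftl_down Ss sx xy.
rewrite /twisted_act; case: ifP => // _.
by apply: bruhat_liftr_down => //; [exact: starS|rewrite shortens_twisted_inv].
Qed.

(** * Signs and sums over intervals *)

Variables (phi : W -> nat) (phiP : is_phi S star phi).
Local Notation κ := (kappa S phi).
Local Open Scope ring_scope.

(** Going down, length and [phi] drop by 1 and 1, or by 2 and 0; either way their half sum drops by
    1. *)
Lemma kappa_twisted_act s w : S s -> I w -> κ (act s w) = - κ w.
Proof.
move=> Ss; wlog sw : w / shortens s w => [H Iw|Iw].
  have [/H->//|sw] := boolP (shortens s w).
  rewrite -[in RHS](twisted_actK w Ss) [in RHS]H ?opprK//.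
    by rewrite shortens_twisted_act.
  exact: twisted_act_closed.
have lt_sw : bruhat_lt S (s * w)%g w.
  split; first by apply: bruhat_shortens => //; exact: reflection_gen.
  by move=> e; move: sw; rewrite /shortens e ltnn.
have [phi1 phi2] := phiP.2 _ _ Iw Ss lt_sw.
rewrite /kappa (coxlen_twisted_act Ss Iw sw); case: eqP => e.
  by rewrite phi1// /twisted_act e eqxx addSn addnS /= exprS mulN1r opprK.
rewrite phi2// /twisted_act; case: eqP => // _.
by rewrite !addSn /= exprS mulN1r opprK.
Qed.

Lemma fsum_kappa_act s (A B : set W) : S s ->
    (forall y, A y -> I y /\ B (act s y)) -> (forall y, B y -> A (act s y)) ->
  \sum_(y \in B) κ y = - \sum_(y \in A) κ y.
Proof.
move=> Ss AB BA; rewrite (reindex_fsbig (act s) A B).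
  rewrite -mulN1r mulr_fsumr; apply: eq_fsbigr => y; rewrite inE => /AB[Iy _].
  by rewrite kappa_twisted_act// mulN1r.
split=> [y /AB[]//|y y' _ _ /(congr1 (act s))|y /BA Ay].
  by rewrite !twisted_actK.
by exists (act s y) => //; exact: twisted_actK.
Qed.

Lemma finite_bruhat_interval x z : finite_set (bruhat_interval S star x z).
Proof. by apply: sub_finite_set (finite_bruhat_ideal z) => y []. Qed.

(** Pairs with [x] not below [z] are included, with an empty interval, because the induction passes
    to [x] and [act s z], which need not be comparable. *)
Lemma fsum_kappa_interval x z : I x -> I z ->
  \sum_(y \in bruhat_interval S star x z) κ y = if x == z then κ x else 0.
Proof.
have [n] := ubnP (len z); elim: n x z => // n IH x z; rewrite ltnS => lz Ix Iz.
have [z1|/eqP/shortens_ex[s Ss sz]] := eqVneq z 1%g.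
  have [xz|xz] := eqVneq x z.
    suff -> : bruhat_interval S star x z = [set x]%classic by rewrite fsbig_set1.
    apply/seteqP; split=> y /=.
      by rewrite xz z1 => -[_ _ /bruhat_le1].
    by move=> ->; split=> //; rewrite -?xz; exact: bruhat_refl.
  suff -> : bruhat_interval S star x z = set0%classic by rewrite fsbig_set0.
  apply/seteqP; split=> y //=.
  rewrite z1 => -[_ + /bruhat_le1 y1]; rewrite y1 => /bruhat_le1 x1.
  by move: xz; rewrite x1 z1 eqxx.
have act_up := twisted_act_up Ss; have act_down := twisted_act_down Ss.
have Iact := twisted_act_closed Ss; have sact := shortens_twisted_act Ss.
have actK w := twisted_actK w Ss.
have [sx|sx] := boolP (shortens s x); last first.
  pose J := bruhat_interval S star x z; have := @fsum_kappa_act s J J Ss.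
  set T := \sum_(_ \in _) _ => TN.
  have {TN} : T = - T.
    by apply: TN => y [Iy xy yz]; repeat split; auto.
  have [xz|_] := eqVneq x z; first by rewrite xz sz in sx.
  by move=> /eqP; rewrite -addr_eq0 -mulr2n mulrn_eq0 => /eqP.
pose x' := act s x; pose z' := act s z.
have sx' : ~~ shortens s x' by rewrite sact ?sx.
have sz' : ~~ shortens s z' by rewrite sact ?sz.
have x'x : x' ≤ x by apply: act_up => //; exact: bruhat_refl.
have z'z : z' ≤ z by apply: act_up => //; exact: bruhat_refl.
have Ix' : I x' by exact: Iact.
have Iz' : I z' by exact: Iact.
have lz' : (len z' < n)%N.
  apply: leq_trans lz; rewrite (coxlen_twisted_act Ss Iz sz) -/z'.
  by case: ifP.
have IHx := IH x z' lz' Ix Iz'; have IHx' := IH x' z' lz' Ix' Iz'.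
pose D : set W := shortens s.
have fin := finite_bruhat_interval.
rewrite (fsbigID D)//= in IHx; rewrite (fsbigID D)//= in IHx'.
rewrite (fsbigID D)//=.
(* If [s] shortens [y], lifting makes [x' ≤ y] and [x ≤ y] equivalent; if it does not, [y ≤ z] and
   [y ≤ z'] are equivalent. *)
have eqD : (bruhat_interval S star x' z' `&` D =
             bruhat_interval S star x z' `&` D)%classic.
  apply/seteqP; split=> y [[Iy xy yz] sy]; split=> //; split=> //.
    by rewrite -[x]actK; exact: act_up.
  exact: bruhat_trans xy.
have eqnD : (bruhat_interval S star x z `&` ~` D =
              bruhat_interval S star x z' `&` ~` D)%classic.
  apply/seteqP; split=> y [[Iy xy yz] sy]; split=> //; split=> //.
    by apply: act_down => //; exact/negP.
  exact: bruhat_trans yz z'z.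
(* [act s] matches the ascents in [[x', z']] with the descents in [[x, z]]. *)
rewrite (@fsum_kappa_act s
           (bruhat_interval S star x' z' `&` ~` D)%classic _ Ss); first last.
- move=> y [[Iy xy yz] Dy]; have {Dy}sy : shortens s y by exact: Dy.
  have nDy : ~ shortens s (act s y) by rewrite sact ?sy.
  split; last exact: nDy.
  have yy : act s y ≤ y by apply: act_up => //; exact: bruhat_refl.
  split; first exact: Iact.
    by apply: act_down => //; exact: bruhat_trans xy.
  apply: act_down; [exact: Iact|by rewrite sact ?sy|exact: bruhat_trans yz].
- move=> y [[Iy xy yz] /negP sy]; split=> //; split; last by rewrite /D /= sact.
  have yy : y ≤ act s y by apply: act_down => //; exact: bruhat_refl.
  split; first exact: Iact.
    rewrite -[x]actK; apply: act_up; [exact: Iact|by rewrite sact|].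
    exact: bruhat_trans yy.
  by apply: act_up => //; exact: bruhat_trans z'z.
rewrite eqnD; rewrite eqD in IHx'.
have xz' : (x == z') = false by apply/eqP => xz'; move: sz'; rewrite -xz' sx.
have x'z' : (x' == z') = (x == z).
  by apply/eqP/eqP => [/(congr1 (act s))|e]; [rewrite !actK|rewrite /x' e].
rewrite xz' in IHx; rewrite x'z' in IHx'.
(* [a] and [u] are the descent and ascent parts of the sum over [[x, z']]; [d] is the ascent part
   over [[x', z']], whose descent part is again [a]. *)
move: IHx IHx'; set a := \sum_(_ \in _) _; set u := \sum_(_ \in _) _.
set d := \sum_(_ \in _) _ => du da.
have -> : - d + u = (a + u) - (a + d) by rewrite addrC opprD addrACA subrr add0r.
rewrite du da sub0r; case: ifP => _; rewrite ?oppr0//.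
by rewrite kappa_twisted_act// opprK.
Qed.

End Twisted.
End Coxeter.

(** Finiteness is asserted too, since a sum with infinite support would be 0 by default. *)
Theorem proposition4p7 (W : groupType) (S : set W)
    (cox : coxeter_system S)
    (star : {multiplicative W -> W})
    (starK : forall w, star (star w) = w)
    (starS : forall s, S s -> S (star s))
    (phi : W -> nat) (phiP : is_phi S star phi)
    (x z : W) (Ix : twisted_involutions star x)
    (Iz : twisted_involutions star z) (xz : bruhat_le S x z) :
  finite_set (bruhat_interval S star x z) /\
  (\sum_(y \in bruhat_interval S star x z) kappa S phi x * kappa S phi y
     = (x == z)%:R :> int)%R.
Proof.
split; first exact: finite_bruhat_interval.
rewrite -mulr_fsumr fsum_kappa_interval//; case: ifP => _; last by rewrite mulr0.
by rewrite -expr2 sqrr_sign.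
Qed.
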